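(* Let $K\subset\mathbb R^m$ be a nonzero closed convex cone. The closed convex set $C\subset\mathbb R^m$ with nonempty interior is $K$-invariant if and only if it is of the form $$C=\bigcap_{i\in\mathbb N}H_-(u_i,a_i),$$ where each hyperplane $H(u_i,a_i)$ is tangent to $C$ and is $K$-invariant.
   Context: $\mathbb R^m$ carries the standard inner product $\langle\cdot,\cdot\rangle$. A convex cone is a nonempty set $K$ with $K+K\subset K$ and $tK\subset K$ for all $t\ge 0$; its dual is $K^*=\{y\in\mathbb R^m:\langle x,y\rangle\ge 0\ \forall x\in K\}$. For a nonempty closed convex set $D$, $P_Dx$ is the unique nearest point of $D$ to $x$. Lattice-like operations: $x\sqcap y=P_{x-K}y$, $x\sqcup y=P_{x+K}y$, $x\sqcap_* y=P_{x-K^*}y$, $x\sqcup_* y=P_{x+K^*}y$. A set $M\subset\mathbb R^m$ is $K$-invariant if for all $x,y\in M$ the points $x\sqcap y,\ x\sqcup y,\ x\sqcap_* y,\ x\sqcup_* y$ all belong to $M$. For $u\ne 0$ and $a\in\mathbb R^m$: $H(u,a)=\{x:\langle u,x\rangle=\langle u,a\rangle\}$ is the hyperplane through $a$ with normal $u$, and $H_-(u,a)=\{x:\langle u,x\rangle\le\langle u,a\rangle\}$. ''Tangent to $C$'' is meant in the usual sense: the tangent hyperplane to the boundary surface of $C$ at a boundary point where this surface is differentiable.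
   Formalization: The intersection is taken over a subset of N, possibly empty, instead of all of N: for C = R^m, which is K-invariant but has no tangent hyperplane, the literal statement fails; for C ≠ R^m the two forms agree by repeating members. *)

(* Defs.v *)
From HB Require Import structures.
From mathcomp Require Import all_boot all_order all_algebra.
From mathcomp Require Import all_classical all_reals all_analysis.

Set Implicit Arguments.
Unset Strict Implicit.
Unset Printing Implicit Defensive.

Import Order.TTheory GRing.Theory Num.Theory.
Import numFieldNormedType.Exports.

Local Open Scope classical_set_scope.
Local Open Scope ring_scope.

Section Euclidean.
Variables (R : realType) (m : nat).
Implicit Types (x y u a e p : 'rV[R]_m) (D K M C H : set 'rV[R]_m).

Definition dot x y : R := \sum_(i < m) x ord0 i * y ord0 i.

(* The library norm `|x| on row vectors is the sup norm: it induces the same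
   topology, but nearest points must be taken for the Euclidean norm. *)
Definition enorm x : R := Num.sqrt (dot x x).

Definition convex_cone K : Prop :=
  [/\ K !=set0,
      forall x y, K x -> K y -> K (x + y)
    & forall (t : R) x, 0 <= t -> K x -> K (t *: x)].

Definition dual_cone K : set 'rV[R]_m :=
  [set y | forall x, K x -> 0 <= dot x y].

(* [get] returns a default vector when D has no point nearest to x; when D
   is nonempty, closed and convex there is exactly one such point. *)
Definition proj D x : 'rV[R]_m :=
  get [set p | D p /\ forall q, D q -> enorm (x - p) <= enorm (x - q)].

Definition lmeet K x y : 'rV[R]_m := proj [set x - k | k in K] y.
Definition ljoin K x y : 'rV[R]_m := proj [set x + k | k in K] y.

Definition K_invariant K M : Prop := forall x y, M x -> M y ->
  [/\ M (lmeet K x y), M (ljoin K x y),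
      M (lmeet (dual_cone K) x y) & M (ljoin (dual_cone K) x y)].

Definition hyperplane u a : set 'rV[R]_m := [set x | dot u x = dot u a].
Definition lower_halfspace u a : set 'rV[R]_m :=
  [set x | dot u x <= dot u a].

Definition boundary C : set 'rV[R]_m := closure C `\` interior C.

(* For a unit vector e, the orthogonal projection onto the complement of e. *)
Definition along e x : 'rV[R]_m := x - dot e x *: e.

(* The boundary surface of C is differentiable at p, with tangent hyperplane H:
   near p, the surface is the graph, over the orthogonal complement of a unit
   vector e, of a function f differentiable at the foot of p, and H is the
   graph of the first-order expansion of f there.  Only the values of f on the
   orthogonal complement of e matter; taking f defined on the whole space
   avoids choosing coordinates on this complement. *)
Definition tangent_at C p H : Prop :=
  exists (e : 'rV[R]_m) (f : 'rV[R]_m -> R),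
    [/\ dot e e = 1,
        boundary C p,
        (\forall x \near p, boundary C x <-> dot e x = f (along e x)),
        differentiable f (along e p)
      & H = [set x | dot e (x - p) = 'd f (along e p) (along e (x - p))]].

Definition tangent_hyperplane C H : Prop := exists p, tangent_at C p H.

End Euclidean.

(* Main.v *)
Require Import Defs.
From mathcomp Require Import all_boot all_order all_algebra.
From mathcomp Require Import all_classical all_reals all_analysis.
From mathcomp Require Import ring lra.
Set Implicit Arguments.
Unset Strict Implicit.
Unset Printing Implicit Defensive.

Import Order.TTheory GRing.Theory Num.Theory.
Import numFieldNormedType.Exports.
Local Open Scope classical_set_scope.
Local Open Scope ring_scope.

(* Write P for the projection onto K. Up to exchanging x and y, Moreau's
   decomposition turns the four operations into x + P (y - x) and y - P (y - x).
   If P preserves the hyperplane orthogonal to u, firm nonexpansiveness puts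
   <u, P z> between 0 and <u, z>, so the halfspaces, and hence their
   intersections, are invariant.
   Conversely, a ball inside C touching the boundary at p forces tangency at p,
   and C contains a small multiple of every direction pointing strictly inward
   at p; invariance of C tested on these directions gives, in the limit,
   invariance of the tangent hyperplane. Taking the largest ball in C around
   each rational interior point yields countably many tangent halfspaces. If y
   is not in C, a ball centred close to the point where a segment from an
   interior point to y leaves C gives a halfspace that excludes y. *)

(** * Inner product, comparison with the sup norm, nearest points *)

Section DotProduct.
Context {R : realType} {m : nat}.
Implicit Types (x y z : 'rV[R]_m) (t : R).

Lemma dotC x y : dot x y = dot y x.
Proof. by apply: eq_bigr => i _; rewrite mulrC. Qed.

Lemma dotDl x y z : dot (x + y) z = dot x z + dot y z.
Proof. by rewrite -big_split; apply: eq_bigr => i _; rewrite mxE mulrDl. Qed.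

Lemma dotZl t x y : dot (t *: x) y = t * dot x y.
Proof. by rewrite /dot mulr_sumr; apply: eq_bigr => i _; rewrite mxE mulrA. Qed.

Lemma dotDr x y z : dot x (y + z) = dot x y + dot x z.
Proof. by rewrite dotC dotDl !(dotC _ x). Qed.

Lemma dotZr t x y : dot x (t *: y) = t * dot x y.
Proof. by rewrite dotC dotZl (dotC y). Qed.

Lemma dotNl x y : dot (- x) y = - dot x y.
Proof. by rewrite -scaleN1r dotZl mulN1r. Qed.

Lemma dotNr x y : dot x (- y) = - dot x y.
Proof. by rewrite dotC dotNl dotC. Qed.

Definition dotE := (dotDl, dotDr, dotZl, dotZr, dotNl, dotNr).

Lemma dot0r x : dot x 0 = 0.
Proof. by rewrite -[0](scale0r 0) dotZr mul0r. Qed.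

Lemma dot_ge0 x : 0 <= dot x x.
Proof. by apply: sumr_ge0 => i _; rewrite -expr2 sqr_ge0. Qed.

Lemma dot_eq0 x : dot x x = 0 -> x = 0.
Proof.
move=> /psumr_eq0P x0; apply/rowP => i; rewrite mxE; apply/eqP.
by rewrite -sqrf_eq0 expr2 x0 // => j _; rewrite -expr2 sqr_ge0.
Qed.

Lemma cauchy_schwarz x y : dot x y ^+ 2 <= dot x x * dot y y.
Proof.
(* The squared norm of this vector is [dot x x] times the defect of the inequality. *)
have := dot_ge0 (dot x x *: y - dot x y *: x); rewrite !dotE (dotC y x).
have := dot_ge0 x; have := dot_ge0 y.
have [/dot_eq0 ->|] := eqVneq (dot x x) 0; first by rewrite dotC !dot0r; nra.
set a := dot x x; set b := dot x y; set c := dot y y => a0 ? ? h.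
have {}a0 : 0 < a by rewrite lt_neqAle eq_sym a0.
rewrite -(ler_pM2l a0); nra.
Qed.

Lemma le_enorm x y : (enorm x <= enorm y) = (dot x x <= dot y y).
Proof. by rewrite /enorm ler_sqrt ?dot_ge0. Qed.

Lemma continuous_dot (T : topologicalType) (f g : T -> 'rV[R]_m) :
  continuous f -> continuous g -> continuous (fun s => dot (f s) (g s)).
Proof.
move=> cf cg; apply: continuous_big => [|i _ t]; first exact: add_continuous.
apply: cvgM; apply: (continuous_comp _ (@coord_continuous _ _ _ _ _ _));
  [exact: cf|exact: cg].
Qed.

Lemma continuous_sqdist x : continuous (fun y => dot (x - y) (x - y)).
Proof.
have cB : continuous (fun y => x - y).
  move=> y; apply: (@continuousB R 'rV[R]_m 'rV[R]_m).
    exact: cst_continuous.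
  exact: cvg_id.
exact: continuous_dot.
Qed.

Lemma sqr_norm_le_dot x : `|x| ^+ 2 <= dot x x.
Proof.
have [->|x0] := eqVneq `|x| 0; first by rewrite expr0n dot_ge0.
have [[i j] /= xij] := mx_norm_neq0 x0.
have -> : `|x| = `|x ord0 j| by rewrite [`|x|]xij (ord1 i).
rewrite real_normK ?num_real // /dot (bigD1 j) //= -expr2 lerDl.
by apply: sumr_ge0 => k _; rewrite -expr2 sqr_ge0.
Qed.

Lemma dot_le_sqr_norm x : dot x x <= m%:R * `|x| ^+ 2.
Proof.
rewrite -[m in m%:R]card_ord mulr_natl -sumr_const; apply: ler_sum => i _.
rewrite -expr2 -real_normK ?num_real // lerXn2r ?nnegrE //.
rewrite [leRHS]mx_normrE.
exact: (le_bigmax _ (fun j : 'I_1 * 'I_m => `|x j.1 j.2|) (ord0, i)).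
Qed.

(** Serves for [K] and for the complement of the interior of [C], which need not be convex. *)
Lemma exists_nearest (D : set 'rV[R]_m) x : closed D -> D !=set0 ->
  exists2 p, D p & forall q, D q -> dot (x - p) (x - p) <= dot (x - q) (x - q).
Proof.
move=> cD [q0 Dq0]; pose d y := dot (x - y) (x - y).
have cd : continuous d by exact: continuous_sqdist.
pose A := D `&` d @^-1` [set t | t <= d q0].
have cA : compact A.
  apply: bounded_closed_compact; last first.
    by apply: closedI => //; apply: closed_comp => // ? _; exact: cd.
  (* The sup norm s of [x - y] satisfies s^2 <= [d q0], hence s <= [d q0 + 1]. *)
  exists (`|x| + d q0 + 1); split; first exact: num_real.
  move=> M hM y [_ /= yq]; apply: le_trans (ltW hM).
  have := le_trans (sqr_norm_le_dot (x - y)) yq.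
  have := ler_normB x (x - y); rewrite subKr => h1 h2.
  have := normr_ge0 (x - y).
  nra.
have [p /set_mem[Dp _] pmin] : exists2 c, c \in A &
    forall q, q \in A -> d c <= d q.
  apply: EVT_min_rV => //; first by exists q0; split => //=.
  exact: continuous_subspaceT.
exists p => // q Dq; have [qq0|/ltW qq0] := leP (d q) (d q0).
  by apply: pmin; apply/mem_set.
by apply: le_trans (qq0); apply: pmin; apply/mem_set; split=> /=.
Qed.

End DotProduct.

(** * Segments, interiors and projections for convex sets *)

Section Affine.
Context {R : realType} {m : nat}.
Implicit Types (x y v : 'rV[R]_m) (C : set 'rV[R]_m) (t : R).

Lemma continuous_line x v : continuous (fun t : R => x + t *: v).
Proof.
move=> t; apply: (@continuousD R 'rV[R]_m R); first exact: cst_continuous.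
exact: scalel_continuous.
Qed.

Lemma convex_segment C x y t : @convex_set R 'rV[R]_m C -> C x -> C y ->
  0 <= t -> t <= 1 -> C (x + t *: (y - x)).
Proof.
move=> cC Cx Cy t0 t1.
have := cC y x (Itv01 t0 t1) (mem_set Cy) (mem_set Cx).
move=> /set_mem; rewrite /conv /=.
suff <- : t *: y + (1 - t) *: x = x + t *: (y - x) by [].
by apply/rowP => i; rewrite !mxE; ring.
Qed.

(** The homothety of centre [y] and ratio [1 - t] maps [C] into itself; [g] is its inverse. *)
Lemma convex_interior C x y t : @convex_set R 'rV[R]_m C ->
  interior C x -> C y -> 0 <= t -> t < 1 -> interior C (x + t *: (y - x)).
Proof.
move=> cC Cx Cy t0 t1; have t1' : 1 - t != 0 by rewrite subr_eq0 gt_eqF.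
pose g z := (1 - t)^-1 *: (z - t *: y).
have gE : g (x + t *: (y - x)) = x.
  by apply/rowP => i; rewrite !mxE; field.
have cg : {for x + t *: (y - x), continuous g}.
  apply: continuous_comp; last exact: scaler_continuous.
  apply: (@continuousB R 'rV[R]_m 'rV[R]_m); first exact: cvg_id.
  exact: cst_continuous.
have : nbhs (x + t *: (y - x)) (g @^-1` C) by apply: cg; rewrite gE.
apply: filterS => z /= Cgz.
have -> : z = g z + t *: (y - g z).
  by apply/rowP => i; rewrite !mxE; field.
by apply: convex_segment => //; exact: ltW.
Qed.

Lemma interior_line C x v : interior C x ->
  exists2 t : R, 0 < t & C (x + t *: v).
Proof.
move=> Cx; have : nbhs (0 : R) ((fun t => x + t *: v) @^-1` C).
  by apply: continuous_line; rewrite scale0r addr0.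
move=> /nbhs_ballP[e /= e0 He]; exists (e / 2); first by lra.
apply: He; rewrite /ball /= sub0r normrN ger0_norm; lra.
Qed.

(** Supplies both the point where a segment leaves [C] and the height function whose graph is the
    boundary. *)
Lemma line_exit C x v t1 : closed C -> C x ->
  (forall t, C (x + t *: v) -> t <= t1) ->
  exists s : R, [/\ 0 <= s, C (x + s *: v) &
    forall t, C (x + t *: v) -> t <= s].
Proof.
move=> cC Cx bd; pose A := (fun t => x + t *: v) @^-1` C.
have ubA : has_ubound A by exists t1 => t; exact: bd.
have A0 : A 0 by rewrite /A /= scale0r addr0.
have cA : closed A by apply: closed_comp => // ? _; exact: continuous_line.
exists (sup A); split.
- exact: ub_le_sup.
- by apply: cA; apply: closure_sup => //; exists 0.
- by move=> t At; exact: ub_le_sup.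
Qed.

Lemma nearest_variational C x p : @convex_set R 'rV[R]_m C -> C p ->
  (forall q, C q -> dot (x - p) (x - p) <= dot (x - q) (x - q)) ->
  forall q, C q -> dot (x - p) (q - p) <= 0.
Proof.
move=> cC Cp pmin q Cq; rewrite leNgt; apply/negP => pos.
set b := dot _ _ in pos; set c := dot (q - p) (q - p).
have c0 : 0 <= c := dot_ge0 _.
(* Moving from [p] by [t] towards [q] changes the squared distance by -2tb + t^2 c, negative for
   this [t]. *)
pose t := b / (b + c).
have bc0 : 0 < b + c by rewrite ltr_wpDr.
have t0 : 0 < t by rewrite divr_gt0.
have t1 : t <= 1 by rewrite ler_pdivrMr // mul1r lerDl.
have tE : t * (b + c) = b by rewrite divfK // gt_eqF.
have := pmin _ (convex_segment cC Cp Cq (ltW t0) t1).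
rewrite opprD addrA.
move: (x - p) (q - p) @b @c pos c0 @t bc0 t0 t1 tE => y z b c.
move=> pos c0 t bc0 t0 t1 tE; rewrite !dotE (dotC z y) -/b -/c; nra.
Qed.

(** The variational inequality gives [far], a strengthened minimality that also forces
    uniqueness. *)
Lemma proj_eq C x p : C p -> (forall q, C q -> dot (x - p) (q - p) <= 0) ->
  Defs.proj C x = p.
Proof.
move=> Cp var.
have far q : C q ->
    dot (x - p) (x - p) + dot (q - p) (q - p) <= dot (x - q) (x - q).
  move=> Cq; have := var q Cq.
  have -> : x - q = (x - p) + (p - q) by rewrite subrKA.
  rewrite -[q - p]opprB.
  move: (x - p) (p - q) => y z; rewrite !dotE (dotC z y) !opprK; lra.
apply: (@get_unique _ (fun p => C p /\
  forall q, C q -> enorm (x - p) <= enorm (x - q))).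
  split=> // q /far; rewrite le_enorm; have := dot_ge0 (q - p); lra.
move=> q [Cq /(_ _ Cp)]; rewrite le_enorm => qp; apply/eqP.
rewrite -subr_eq0; apply/eqP/dot_eq0/eqP; rewrite eq_le dot_ge0 andbT.
have := far q Cq; lra.
Qed.

End Affine.

(** * Projection onto a closed cone; invariance of halfspaces *)

Section ConeProjection.
Context {R : realType} {m : nat}.
Implicit Types (x y z u a p q : 'rV[R]_m) (K M : set 'rV[R]_m) (t : R).

(* Moreau's characterization of [p] as the nearest point of [K] to [z]. *)
Definition cone_proj K z p : Prop :=
  [/\ K p, dot (z - p) p = 0 & forall k, K k -> dot (z - p) k <= 0].

(** The variational inequality at [k + p] gives the sign condition on [K]; at [0] it gives the other
    half of orthogonality. *)
Lemma cone_proj_exists K z : convex_cone K -> closed K ->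
  exists p, cone_proj K z p.
Proof.
move=> [K0 KD KZ] cK.
have K00 : K 0 by have [k Kk] := K0; rewrite -(scale0r k); exact: KZ.
have convK : @convex_set R 'rV[R]_m K.
  move=> x y l /set_mem Kx /set_mem Ky; apply/mem_set.
  by apply: KD; apply: KZ => //; rewrite subr_ge0.
have [p Kp pmin] := exists_nearest z cK K0; exists p.
have var := nearest_variational convK Kp pmin.
have neg k : K k -> dot (z - p) k <= 0.
  by move=> Kk; have := var _ (KD _ _ Kk Kp); rewrite addrK.
split=> //; apply/eqP; rewrite eq_le neg //=.
by have := var _ K00; rewrite sub0r dotNr oppr_le0.
Qed.

Lemma cone_projZ K z p t : convex_cone K -> 0 <= t ->
  cone_proj K z p -> cone_proj K (t *: z) (t *: p).
Proof.
move=> [_ _ KZ] t0 [Kp zp0 zpk]; split; first exact: KZ.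
  by rewrite -scalerBr dotZl dotZr zp0 !mulr0.
by move=> k Kk; rewrite -scalerBr dotZl mulr_ge0_le0 // zpk.
Qed.

(** Moreau: [- z] is the sum of the orthogonal vectors [p - z], in the dual cone, and [- p],
    nonpositive on it. *)
Lemma cone_proj_dual K z p :
  cone_proj K z p -> cone_proj (dual_cone K) (- z) (p - z).
Proof.
move=> [Kp zp0 zpk].
have E : - z - (p - z) = - p by rewrite opprB addKr.
split.
- by move=> k /zpk; rewrite -(opprB z p) dotNr dotC oppr_ge0.
- by rewrite E dotNl -(opprB z p) dotNr dotC zp0 !oppr0.
- by move=> k /(_ _ Kp); rewrite E dotNl oppr_le0.
Qed.

(** Each residual is tested on the other projection. *)
Lemma cone_proj_firm K z z' p p' : cone_proj K z p -> cone_proj K z' p' ->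
  dot (p - p') (p - p') <= dot (p - p') (z - z').
Proof.
move=> [Kp e1 h1] [Kp' e2 h2]; have := h1 _ Kp'; have := h2 _ Kp.
move: e1 e2; rewrite !dotE (dotC p z) (dotC p' z) (dotC p z') (dotC p' z').
rewrite (dotC p p'); lra.
Qed.

(** Encodes, for either sign of [t], that [dot u (q - p)] lies between [0] and [t * dot u u]. *)
Lemma cone_proj_shift K u z p q t :
  cone_proj K z p -> cone_proj K (z + t *: u) q ->
  dot u (q - p) ^+ 2 <= t * dot u u * dot u (q - p).
Proof.
move=> zp zq; apply: le_trans (cauchy_schwarz _ _) _.
rewrite mulrAC [leRHS]mulrC ler_wpM2l ?dot_ge0 //.
by have := cone_proj_firm zq zp; rewrite addrAC subrr add0r dotZr (dotC _ u).
Qed.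

Lemma ljoin_eq K x y p : cone_proj K (y - x) p -> ljoin K x y = x + p.
Proof.
move=> [Kp e h]; apply: proj_eq; first by exists p.
move=> _ [k Kk <-]; rewrite opprD addrACA subrr add0r addrA dotDr dotNr e.
by rewrite subr0 h.
Qed.

Lemma lmeet_eq K x y p : cone_proj K (x - y) p -> lmeet K x y = x - p.
Proof.
move=> [Kp e h]; apply: proj_eq; first by exists p.
move=> _ [k Kk <-].
have -> : y - (x - p) = - (x - y - p) by apply/rowP => i; rewrite !mxE; ring.
have -> : x - k - (x - p) = - (k - p) by apply/rowP => i; rewrite !mxE; ring.
by rewrite dotNl dotNr opprK dotDr dotNr e subr0 h.
Qed.

(* The operations of the dual cone bring nothing new, by Moreau's
   decomposition. *)
Lemma K_invariantP K M : convex_cone K -> closed K ->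
  K_invariant K M <-> forall x y p, M x -> M y -> cone_proj K (y - x) p ->
    M (x + p) /\ M (y - p).
Proof.
move=> coneK closedK; split=> [inv x y p Mx My xyp|inv x y Mx My].
  have [_ Mj _ _] := inv x y Mx My; have [Mm _ _ _] := inv y x My Mx.
  by rewrite -(ljoin_eq xyp) -(lmeet_eq xyp).
have [p xyp] := cone_proj_exists (y - x) coneK closedK.
have [q yxq] := cone_proj_exists (x - y) coneK closedK.
have [Mxp Myp] := inv x y p Mx My xyp; have [Myq Mxq] := inv y x q My Mx yxq.
have xyp' := cone_proj_dual xyp; have yxq' := cone_proj_dual yxq.
rewrite opprB in xyp'; rewrite opprB in yxq'.
rewrite (ljoin_eq xyp) (lmeet_eq yxq) (ljoin_eq yxq') (lmeet_eq xyp').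
split=> //.
  by have -> : x - (p + (x - y)) = y - p by apply/rowP => i; rewrite !mxE; ring.
by have -> : x + (q + (y - x)) = y + q by apply/rowP => i; rewrite !mxE; ring.
Qed.

(* Firm nonexpansiveness puts [<u, P_K z>] between [0] and [<u, z>]. *)
Lemma lower_halfspace_invariant K u a : convex_cone K -> closed K -> u != 0 ->
  K_invariant K (hyperplane u a) -> K_invariant K (lower_halfspace u a).
Proof.
move=> coneK closedK u0 /(K_invariantP _ coneK closedK) inv.
apply/(K_invariantP _ coneK closedK) => x y p Hx Hy xyp.
have uu : dot u u != 0 by apply: contra u0 => /eqP/dot_eq0 ->.
(* The part [z] of [y - x] orthogonal to [u] joins two points of the hyperplane, so its projection
   [q] is orthogonal to [u]; the shift estimate then restores [t *: u]. *)
pose t := dot u (y - x) / dot u u; pose z := y - x - t *: u.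
have uz : dot u z = 0 by rewrite /z dotDr dotNr dotZr divfK // subrr.
have [q zq] := cone_proj_exists z coneK closedK.
have azq : cone_proj K (a + z - a) q by rewrite [a + z]addrC addrK.
have Haz : hyperplane u a (a + z) by rewrite /hyperplane /= dotDr uz addr0.
have [+ _] := inv a (a + z) q erefl Haz azq.
rewrite /hyperplane /= dotDr => uq.
have {}uq : dot u q = 0 by lra.
have : cone_proj K (z + t *: u) p by rewrite subrK.
move=> /(cone_proj_shift zq).
rewrite /t divfK // !(dotDr u) !(dotNr u) uq subr0 expr2; move: Hx Hy.
rewrite /lower_halfspace /= !(dotDr u) !(dotNr u).
move: (dot u x) (dot u y) (dot u a) (dot u p) => X Y A s XA YA.
(* Cancelling a nonzero [s] from s^2 <= (Y - X) s places it between 0 and [Y - X]. *)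
have [s0|s0|->] := ltgtP s 0; last by split; lra.
  by rewrite ler_nM2r // => ?; split; lra.
by rewrite ler_pM2r // => ?; split; lra.
Qed.

Lemma bigcap_invariant K (I : set nat) (F : nat -> set 'rV[R]_m) :
  (forall i, I i -> K_invariant K (F i)) ->
  K_invariant K (\bigcap_(i in I) F i).
Proof.
move=> inv x y Fx Fy.
by split=> i Ii; have [] := inv i Ii _ _ (Fx i Ii) (Fy i Ii).
Qed.

End ConeProjection.

(** * Balls touching the boundary from inside *)

Section TouchingBall.
Context {R : realType} {m : nat}.
Implicit Types (x y z e p v : 'rV[R]_m) (C K : set 'rV[R]_m) (r t : R).

(** At the contact point [x + r *: e] the boundary of a convex [C] is differentiable with outer
    normal [e]; this may fail at other boundary points. *)
Definition touching_ball C x e r : Prop :=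
  [/\ dot e e = 1, 0 < r, boundary C (x + r *: e)
    & forall y, dot (y - x) (y - x) < r ^+ 2 -> interior C y].

Lemma boundaryE C p : closed C -> boundary C p <-> C p /\ ~ interior C p.
Proof. by move=> cC; rewrite /boundary -(closure_id C).1. Qed.

Lemma touching_ball_exists C x : closed C -> C <> setT -> interior C x ->
  exists e r, touching_ball C x e r.
Proof.
move=> cC CT Cx.
have cD : closed (~` interior C) by apply: open_closedC; exact: open_interior.
have D0 : ~` interior C !=set0.
  apply: contrapT => /nonemptyPn D0; apply: CT; rewrite -subTset => y _.
  apply: interior_subset; apply: contrapT => ny.
  by have : (~` interior C) y by []; rewrite D0.
have [p Dp pmin] := exists_nearest x cD D0.
have inball y : dot (x - y) (x - y) < dot (x - p) (x - p) -> interior C y.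
  by move=> yp; apply: contrapT => /pmin; rewrite leNgt yp.
have xp0 : 0 < dot (x - p) (x - p).
  rewrite lt_neqAle dot_ge0 andbT eq_sym; apply/eqP => /dot_eq0/eqP.
  by rewrite subr_eq0 => /eqP xp; apply: Dp; rewrite -xp.
pose r := enorm (x - p).
have rr : r ^+ 2 = dot (x - p) (x - p) by rewrite sqr_sqrtr ?dot_ge0.
have r0 : 0 < r by rewrite sqrtr_gt0.
exists (r^-1 *: (p - x)), r; split=> //.
- rewrite -(opprB x p) dotZl dotZr dotNl dotNr -rr; field; exact: lt0r_neq0.
- rewrite scalerA divff ?lt0r_neq0 // scale1r addrC subrK.
  (* Moving from [p] towards [x] enters the open ball at once, so [p] is a limit of points of
     [C]. *)
  apply/boundaryE => //; split=> //; rewrite (closure_id C).1 // => B Bp.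
  have : nbhs (0 : R) ((fun t => p + t *: (x - p)) @^-1` B).
    by apply: continuous_line; rewrite scale0r addr0.
  move=> /nbhs_ballP[d /= d0 dB]; pose t := Num.min (d / 2) 1.
  have t0 : 0 < t by rewrite lt_min divr_gt0 // ltr01.
  have td : t < d by rewrite gt_min; apply/orP; left; lra.
  have t1 : t <= 1 by rewrite ge_min lexx orbT.
  exists (p + t *: (x - p)); split; last first.
    by apply: dB; rewrite /ball /= sub0r normrN gtr0_norm.
  apply: interior_subset; apply: inball.
  have -> : x - (p + t *: (x - p)) = (1 - t) *: (x - p).
    by apply/rowP => i; rewrite !mxE; ring.
  have t2 : 0 < 2 - t by lra.
  have := mulr_gt0 (mulr_gt0 t0 t2) xp0.
  rewrite dotZl dotZr; lra.
- move=> y; rewrite rr => h; apply: inball.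
  by rewrite -(opprB y x) dotNl dotNr opprK.
Qed.

Lemma touching_ball_inward C x e r v : touching_ball C x e r -> dot e v < 0 ->
  exists2 t, 0 < t & interior C (x + r *: e + t *: v).
Proof.
move=> [ee r0 _ inball] ev; have vv := dot_ge0 v.
have V0 : 0 < dot v v + 1 by lra.
(* The squared norm of [r *: e + t *: v] is r^2 + 2rt<e,v> + t^2 |v|^2; this [t] makes the last term
   less than -rt<e,v>. *)
pose t := r * - dot e v / (dot v v + 1).
have tE : t * (dot v v + 1) = r * - dot e v by rewrite divfK ?lt0r_neq0.
have t0 : 0 < t by rewrite divr_gt0 // mulr_gt0 // oppr_gt0.
exists t => //; apply: inball; 
have -> : x + r *: e + t *: v - x = r *: e + t *: v.
  by apply/rowP => i; rewrite !mxE; ring.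
rewrite !dotE (dotC v e) ee; nra.
Qed.

(** Were [y] beyond the hyperplane, the segment from [y] prolonged past the contact point would
    enter the interior, making the contact point interior. *)
Lemma touching_ball_support C x e r y : closed C ->
  @convex_set R 'rV[R]_m C -> touching_ball C x e r -> C y ->
  dot e y <= dot e (x + r *: e).
Proof.
move=> cC convC tb Cy; rewrite leNgt; apply/negP => ey.
have [_ _ /(boundaryE _ cC)[_ pC] _] := tb.
have inw := @touching_ball_inward _ _ _ _ (x + r *: e - y) tb.
move: (x + r *: e) inw pC ey => p inw pC ey.
have [|t t0 Ct] := inw; first by rewrite dotDr dotNr; lra.
apply: pC.
have t1 : 1 + t != 0 by rewrite lt0r_neq0 // ltr_wpDr // ltW.
have -> : p = p + t *: (p - y) + (t / (1 + t)) *: (y - (p + t *: (p - y))).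
  by apply/rowP => i; rewrite !mxE; field.
apply: convex_interior => //; first by rewrite divr_ge0 ?addr_ge0 // ltW.
by rewrite ltr_pdivrMr; lra.
Qed.

Lemma touching_ball_invariant K C x e r : convex_cone K -> closed K ->
  closed C -> @convex_set R 'rV[R]_m C -> touching_ball C x e r ->
  K_invariant K C -> K_invariant K (hyperplane e (x + r *: e)).
Proof.
move=> coneK closedK closedC convC tb /(K_invariantP _ coneK closedK) inv.
apply/(K_invariantP _ coneK closedK).
have [ee r0 /boundaryE-/(_ closedC)[Cp _] _] := tb.
(* By homogeneity [z] can be shrunk until it leads from the contact point into [C]; the join of the
   two points stays below the supporting hyperplane. [pos] uses the meet and the direction [- z]. *)
have neg z q : dot e z < 0 -> cone_proj K z q -> dot e q <= 0.
  move=> ez zq; have [t t0 /interior_subset Ct] := touching_ball_inward tb ez.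
  have ptz : cone_proj K (x + r *: e + t *: z - (x + r *: e)) (t *: q).
    by rewrite addrAC subrr add0r; apply: cone_projZ => //; exact: ltW.
  have [/(touching_ball_support closedC convC tb) + _] := inv _ _ _ Cp Ct ptz.
  by rewrite (dotDr e _ (t *: q)) dotZr gerDl pmulr_rle0.
have pos z q : 0 < dot e z -> cone_proj K z q -> 0 <= dot e q.
  rewrite -oppr_lt0 -dotNr => ez zq.
  have [t t0 /interior_subset Ct] := touching_ball_inward tb ez.
  have ptz : cone_proj K (x + r *: e - (x + r *: e + t *: - z)) (t *: q).
    rewrite opprD addrA subrr add0r scalerN opprK.
    by apply: cone_projZ => //; exact: ltW.
  have [_ /(touching_ball_support closedC convC tb)] := inv _ _ _ Ct Cp ptz.
  by rewrite (dotDr e _ (- _)) dotNr dotZr gerDl oppr_le0 pmulr_rge0.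
have zero z q : dot e z = 0 -> cone_proj K z q -> dot e q = 0.
  move=> ez zq; apply/eqP; rewrite eq_le; apply/andP; split.
    (* Tilting [z] inward by [d] makes [neg] apply; the shift estimate bounds the change of
       [dot e q] by [d]. *)
    apply/ler_addgt0Pr => d d0; rewrite add0r.
    have [q' zq'] := cone_proj_exists (z + (- d) *: e) coneK closedK.
    have ez' : dot e (z + (- d) *: e) < 0.
      by rewrite dotDr dotZr ez ee add0r mulr1 oppr_lt0.
    have := neg _ _ ez' zq'; have := cone_proj_shift zq zq'.
    rewrite ee mulr1 dotDr dotNr; nra.
  apply/ler_addgt0Pr => d d0.
  have [q' zq'] := cone_proj_exists (z + d *: e) coneK closedK.
  have ez' : 0 < dot e (z + d *: e).
    by rewrite dotDr dotZr ez ee add0r mulr1.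
  have := pos _ _ ez' zq'; have := cone_proj_shift zq zq'.
  rewrite ee mulr1 dotDr dotNr; nra.
move=> y z q; rewrite /hyperplane /= => Hy Hz yzq.
have eq0 : dot e q = 0 by apply: zero yzq; rewrite dotDr dotNr Hy Hz subrr.
by rewrite (dotDr e y) (dotDr e z) dotNr eq0 Hy Hz oppr0 addr0.
Qed.

End TouchingBall.

(** * Tangency at a contact point *)

Section Tangent.
Context {R : realType} {m : nat}.
Implicit Types (x y z e p v w : 'rV[R]_m) (C K : set 'rV[R]_m) (r t : R).

Lemma flat_differentiable (f : 'rV[R]_m -> R) w (c : R) :
  (\forall v \near w, `|f v - f w| <= c * `|v - w| ^+ 2) ->
  differentiable f w /\ 'd f w = (fun=> 0) :> ('rV[R]_m -> R).
Proof.
move=> fw; pose L : {linear 'rV[R]_m -> R} := (\0%R : 'rV[R]_m -> R).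
have cL : continuous L by exact: cst_continuous.
have fL (eps : R) : 0 < eps ->
    \forall h \near (0 : 'rV[R]_m), `|f (h + w) - (f w + 0)| <= eps * `|h|.
  move=> eps0.
  (* The sign of [c] is unknown; this denominator is positive and exceeds [c]. *)
  have c0 : 0 < `|c| + 1 by rewrite ltr_wpDl.
  have small : \forall h \near (0 : 'rV[R]_m), `|h| < eps / (`|c| + 1).
    apply/nbhs_norm0P; exists (eps / (`|c| + 1)) => //=.
    by rewrite divr_gt0.
  have fw0 : \forall h \near (0 : 'rV[R]_m),
      `|f (h + w) - f w| <= c * `|h + w - w| ^+ 2.
    move: fw; rewrite (near_shift 0 w).
    by apply: filterS => h; rewrite /= subr0.
  apply: filterS2 fw0 small => h /=; rewrite addrK => fh.
  rewrite ltr_pdivlMr // => hc.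
  rewrite addr0; apply: le_trans fh _.
  have := ler_norm c; have := normr_ge0 h; nra.
have dfE : 'd f w = L :> ('rV[R]_m -> R).
  by apply: diff_unique => //; apply/eqaddoP; exact: fL.
split; last by rewrite dfE.
by apply/diff_locallyP; rewrite dfE; split=> //; apply/eqaddoP; exact: fL.
Qed.

Lemma continuous_dotr e : continuous (dot e).
Proof.
by apply: continuous_dot => [|w]; [exact: cst_continuous|exact: cvg_id].
Qed.

Lemma continuous_along e : continuous (along e).
Proof.
move=> w.
apply: (@continuousB R 'rV[R]_m 'rV[R]_m id (fun w => dot e w *: e)).
  exact: cvg_id.
exact: (continuous_comp (@continuous_dotr e w) (@scalel_continuous _ _ e _)).
Qed.

Lemma along_orth e w : dot e e = 1 -> dot e (along e w) = 0.
Proof. by move=> ee; rewrite /along dotDr dotNr dotZr ee mulr1 subrr. Qed.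

Lemma along_shift e w t : dot e e = 1 -> along e (w + t *: e) = along e w.
Proof.
move=> ee; rewrite /along dotDr dotZr ee.
by apply/rowP => i; rewrite !mxE; ring.
Qed.

Lemma along_id e w : dot e e = 1 -> along e (along e w) = along e w.
Proof. by move=> ee; rewrite {1}/along along_orth // scale0r subr0. Qed.

Lemma alongK e w : along e w + dot e w *: e = w.
Proof. by rewrite /along subrK. Qed.

Lemma dot_along_le e w : dot e e = 1 -> dot (along e w) (along e w) <= dot w w.
Proof.
move=> ee; have := sqr_ge0 (dot e w).
by rewrite /along !dotE (dotC w e) ee expr2; lra.
Qed.

Lemma along_sub e w v : along e w - along e v = along e (w - v).
Proof.
by rewrite /along dotDr dotNr; apply/rowP => i; rewrite !mxE; ring.
Qed.

(* Squeezing the boundary between its supporting hyperplane at the touching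
   point and the sphere makes it differentiable there, with derivative 0. *)
Lemma touching_ball_tangent C x e r : closed C -> @convex_set R 'rV[R]_m C ->
  touching_ball C x e r ->
  tangent_at C (x + r *: e) (hyperplane e (x + r *: e)).
Proof.
move=> closedC convC tb; have [ee r0 bp inball] := tb.
have [Cp pC] := (boundaryE _ closedC).1 bp.
have supp := touching_ball_support closedC convC tb.
pose tx := dot e x; have ep : dot e (x + r *: e) = tx + r.
  by rewrite dotDr dotZr ee mulr1.
(* [f w] is the greatest height of [C] over the foot of [w]. It is shown to exist on the cylinder
   [d w < r ^+ 2] spanned by the ball, [d w] being the squared distance to the axis. *)
pose top w s := C (along e w + s *: e) /\
  forall t, C (along e w + t *: e) -> t <= s.
pose f w := get (top w).
pose d w := dot (along e w - along e x) (along e w - along e x).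
have dot_top w t : dot e (along e w + t *: e) = t.
  by rewrite dotDr dotZr along_orth // ee mulr1 add0r.
have ub w t : C (along e w + t *: e) -> t <= tx + r.
  by move=> /supp; rewrite dot_top ep.
have inball' w t : d w + (t - tx) ^+ 2 < r ^+ 2 ->
    interior C (along e w + t *: e).
  move=> h; apply: inball.
  have -> : along e w + t *: e - x = along e w - along e x + (t - tx) *: e.
    rewrite -{1}[x](alongK e) -/tx.
    move: (along e w) (along e x) => a b.
    by apply/rowP => i; rewrite !mxE; ring.
  move: h; rewrite /d !along_sub; move: (along_orth (w - x) ee).
  by move: (along e (w - x)) => v ev; rewrite !dotE (dotC v e) ev ee expr2; lra.
have base w : d w < r ^+ 2 -> interior C (along e w + tx *: e).
  by move=> dw; apply: inball'; rewrite subrr expr0n addr0.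
have fP w : d w < r ^+ 2 -> top w (f w).
  move=> /base/interior_subset Cw.
  have bd t : C (along e w + tx *: e + t *: e) -> t <= r.
    by rewrite -addrA -scalerDl => /ub; rewrite lerD2l.
  have [s [s0 Cs smax]] := line_exit closedC Cw bd.
  apply: (@getPex _ (top w)); exists (tx + s); split.
    by rewrite scalerDl addrA.
  move=> t Ct; rewrite -lerBlDl; apply: smax.
  by rewrite -addrA -scalerDl subrKC.
have r2 : 0 < r ^+ 2 by rewrite exprn_gt0.
pose w0 := along e (x + r *: e).
have w0E : w0 = along e x by rewrite /w0 along_shift.
have dE w : d w = dot (along e (w - w0)) (along e (w - w0)).
  by rewrite /d -along_sub w0E along_id.
have dw0 : d w0 = 0 by rewrite dE subrr /along dot0r scale0r subrr dot0r.
have fw0 : f w0 = tx + r.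
  have [|Cf fmax] := fP w0; first by rewrite dw0.
  apply/eqP; rewrite eq_le (ub _ _ Cf) /=; apply: fmax.
  by rewrite {1}/w0 along_id // -ep alongK.
have cdalong : continuous d.
  have cd : continuous (fun w => along e w - along e x).
    move=> w; apply: (@continuousB R 'rV[R]_m 'rV[R]_m).
      exact: continuous_along.
    exact: cst_continuous.
  exact: continuous_dot.
have near_d z : d z < r ^+ 2 -> \forall w \near z, d w < r ^+ 2.
  by move=> dz; exact: cvgr_lt (cdalong z) _ dz.
(* Off the axis this paraboloid is inside the open ball: with q = d w / r, qr + (r - q)^2 = r^2 -
   q(r - q). On the axis it meets the contact point. *)
have flow w : d w < r ^+ 2 -> tx + r - d w / r <= f w.
  move=> dw; have [Cf fmax] := fP w dw.
  have [d0|dn0] := eqVneq (d w) 0.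
    rewrite d0 mul0r subr0; apply: fmax; move: d0 => /dot_eq0/eqP.
    by rewrite subr_eq0 => /eqP ->; rewrite -w0E -ep alongK.
  apply: fmax; apply: interior_subset; apply: inball'.
  have d0 : 0 < d w by rewrite lt_neqAle eq_sym dn0 dot_ge0.
  pose q := d w / r; have qr : q * r = d w by rewrite divfK ?gt_eqF.
  rewrite -/q -qr in d0 dw *.
  have q0 : 0 < q by rewrite -(pmulr_lgt0 _ r0).
  have qr' : q < r by rewrite -(ltr_pM2r r0) -expr2.
  have : 0 < q * (r - q) by rewrite mulr_gt0 // subr_gt0.
  by rewrite !expr2; lra.
have [df dfE] : differentiable f w0 /\ 'd f w0 = (fun=> 0) :> ('rV[R]_m -> R).
  (* The factor [m] passes from the Euclidean to the sup norm. *)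
  apply: (@flat_differentiable _ _ (m%:R / r)).
  have : \forall w \near w0, d w < r ^+ 2 by apply: near_d; rewrite dw0.
  apply: filterS => w dw.
  have := flow w dw; have [Cf _] := fP w dw; have := ub _ _ Cf.
  rewrite fw0 => h1 h2; rewrite ler0_norm ?subr_le0 //.
  have : d w <= m%:R * `|w - w0| ^+ 2.
    rewrite dE; apply: le_trans (dot_along_le _ ee) (dot_le_sqr_norm _).
  rewrite -(ler_pM2r (x := r^-1)) ?invr_gt0 // => h3.
  rewrite mulrAC; lra.
exists e, f; split=> //.
- have near1 : \forall z \near x + r *: e, d z < r ^+ 2.
    by apply: near_d; rewrite /d -/w0 w0E subrr dot0r.
  (* This discards the lower sheet of the boundary over the cylinder. *)
  have near2 : \forall z \near x + r *: e, tx < dot e z.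
    have txp : tx < dot e (x + r *: e) by rewrite ep ltrDl.
    exact: cvgr_gt (@continuous_dotr e _) _ txp.
  apply: filterS2 near1 near2 => z dz tz.
  have fE : f (along e z) = f z by rewrite /f /top along_id.
  have [Cf fmax] := fP z dz.
  rewrite fE; split.
    move=> /(boundaryE _ closedC)[Cz iz].
    apply/eqP; rewrite eq_le fmax ?alongK //=.
    rewrite leNgt; apply/negP => zf; apply: iz.
    have tf : f z - tx != 0 by rewrite lt0r_neq0 // subr_gt0 (lt_trans tz).
    (* [z] lies on the segment from the interior point at height [tx] to the top, strictly before
       the top. *)
    have -> : z = along e z + tx *: e + ((dot e z - tx) / (f z - tx)) *:
        (along e z + f z *: e - (along e z + tx *: e)).
      rewrite -{1}(alongK e z); apply/rowP => i; rewrite !mxE; field.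
      by [].
    apply: convex_interior => //; first exact: base.
      by rewrite divr_ge0 // subr_ge0 ltW // (lt_trans tz).
    by rewrite ltr_pdivrMr ?mul1r ?ltrD2r // subr_gt0 (lt_trans tz).
  move=> zf; apply/boundaryE => //; split; first by rewrite -(alongK e z) zf.
  move=> /(interior_line e)[t t0]; rewrite -{1}(alongK e z) -addrA -scalerDl.
  by move=> /fmax; rewrite zf gerDl leNgt t0.
- rewrite dfE /hyperplane; apply/seteqP; split=> z /=.
    by rewrite (dotDr e z) dotNr => ->; rewrite subrr.
  by rewrite (dotDr e z) dotNr => /eqP; rewrite subr_eq0 => /eqP.
Qed.

End Tangent.

(** * Rational centres and separation of outside points *)

Section Separation.
Context {R : realType} {m : nat}.
Implicit Types (x y z e p q v : 'rV[R]_m) (C K : set 'rV[R]_m) (r t : R).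

(** Balls of the sup norm are boxes, so coordinates are approximated independently. *)
Lemma rat_dense_row (O : set 'rV[R]_m) : open O -> O !=set0 ->
  exists v : 'rV[rat]_m, O (map_mx ratr v).
Proof.
move=> oO [x Ox].
have /nbhs_ballP[d /= d0 dO] := open_nbhs_nbhs (conj oO Ox).
have /choice[v vP] : forall j : 'I_m, exists c : rat, `|x ord0 j - ratr c| < d.
  move=> j; have /rat_in_itvoo[c] : x ord0 j - d < x ord0 j + d by lra.
  rewrite in_itv /= => /andP[h1 h2].
  by exists c; rewrite ltr_norml; apply/andP; split; lra.
exists (\row_j v j); apply: dO; split=> // i j.
by rewrite !mxE (ord1 i); exact: vP.
Qed.

(* The centre of the separating ball is taken near the point where the segment
   from an interior point to [y] leaves [C]. *)
Lemma touching_ball_separation C x0 y : closed C ->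
  @convex_set R 'rV[R]_m C -> interior C x0 -> ~ C y ->
  exists v : 'rV[rat]_m, interior C (map_mx ratr v) /\
    forall e r, touching_ball C (map_mx ratr v) e r ->
      dot e (map_mx ratr v + r *: e) < dot e y.
Proof.
move=> closedC convC Cx0 Cy; have Cx0' := interior_subset Cx0.
have [rho rho0 Cx0rho] : exists2 rho, 0 < rho &
    forall e, dot e e = 1 -> C (x0 + rho *: e).
  have /nbhs_ballP[d /= d0 dC] := Cx0; exists (d / 2).
    by rewrite divr_gt0.
  move=> e ee; apply: dC; rewrite -ball_normE /=.
  rewrite opprD addrA subrr sub0r normrN normrZ gtr0_norm ?divr_gt0 //.
  have := sqr_norm_le_dot e; rewrite ee expr_le1 // => e1.
  have := normr_ge0 e; nra.
have bd t : C (x0 + t *: (y - x0)) -> t <= 1.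
  move=> Ct; rewrite leNgt; apply/negP => t1; apply: Cy.
  have t0 : 0 < t by apply: lt_trans t1.
  have -> : y = x0 + t^-1 *: (x0 + t *: (y - x0) - x0).
    by apply/rowP => i; rewrite !mxE; field; exact: lt0r_neq0.
  by apply: convex_segment; rewrite ?invr_ge0 ?invf_le1 ?ltW.
have [s [s0 Cq smax]] := line_exit closedC Cx0' bd.
have s1 : s < 1.
  rewrite lt_neqAle bd // andbT; apply/eqP => s1; apply: Cy.
  by move: Cq; rewrite s1 scale1r addrC subrK.
set q := x0 + s *: (y - x0) in Cq.
have qC : ~ interior C q.
  move=> /(interior_line (y - x0))[t t0].
  by rewrite -addrA -scalerDl => /smax; rewrite gerDl leNgt t0.
(* Let h be the height along [e] of the contact point. If h were at least that of [y], support at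
   [x0 + rho *: e] would put [q] at height at most h - (1 - s) rho = h - 2d. But [r < d] and a
   centre within [d] of [q] put [q] above h - 2d. *)
pose d := (1 - s) * rho / 2.
have d0 : 0 < d by rewrite divr_gt0 // mulr_gt0 // subr_gt0.
pose O := interior C `&` [set x | dot (q - x) (q - x) < d ^+ 2].
have oO : open O.
  apply: openI; first exact: open_interior.
  apply: (@open_comp _ _ (fun x => dot (q - x) (q - x)) [set c | c < d ^+ 2]).
    by move=> x _; exact: continuous_sqdist.
  exact: open_lt.
have O0 : O !=set0.
  (* The point at fraction [c] of the way from [q] to [x0] has squared distance c^2 V to [q], less
     than d^2 = c^2 D^2. *)
  pose V := dot (q - x0) (q - x0); have V0 : 0 <= V := dot_ge0 _.
  pose D := d + 1 + V; have D1 : 1 + V < D by rewrite /D; lra.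
  have D0 : 0 < D by lra.
  pose c := d / D; have cE : d = c * D by rewrite divfK ?lt0r_neq0.
  have c0 : 0 < c by rewrite divr_gt0.
  have c1 : c <= 1 by rewrite ler_pdivrMr // mul1r /D; lra.
  exists (x0 + (1 - c) *: (q - x0)); split.
    by apply: convex_interior => //; lra.
  rewrite /=; have -> : q - (x0 + (1 - c) *: (q - x0)) = c *: (q - x0).
    by apply/rowP => i; rewrite !mxE; ring.
  rewrite dotZl dotZr -/V; have -> : d ^+ 2 = c * (c * (D * D)).
    by rewrite expr2 {1 2}cE; ring.
  rewrite !ltr_pM2l //; nra.
have [v [Cv qv]] := rat_dense_row oO O0.
exists v; split=> // e r tb; move: (map_mx _ _) Cv qv tb => x Cx /= qx tb.
have [ee r0 _ inball] := tb; rewrite ltNge; apply/negP => ey.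
have := touching_ball_support closedC convC tb (Cx0rho _ ee).
(* The ball misses [q], which is not interior. *)
have rd : r < d.
  have : ~~ (dot (q - x) (q - x) < r ^+ 2) by apply/negP => /inball.
  rewrite -leNgt => /le_lt_trans/(_ qx).
  by rewrite ltr_pXn2r // nnegrE ltW.
have eqx : - d < dot e (q - x).
  have := cauchy_schwarz e (q - x); rewrite ee mul1r => /le_lt_trans/(_ qx).
  rewrite -real_normK ?num_real // ltr_pXn2r ?nnegrE ?normr_ge0 ?ltW //.
  by rewrite ltr_norml => /andP[].
move: eqx ey; rewrite /q !(dotDr e) !dotNr !dotZr !(dotDr e) !dotNr ee.
have dE : d * 2 = (1 - s) * rho by rewrite divfK.
move: (dot e x0) (dot e x) (dot e y) => X0 X Y.
clearbody d.
move=> h1 h2 h3.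
have : 0 <= s * (X + r * 1 - Y) by rewrite mulr_ge0 //; lra.
have : 0 <= (1 - s) * (X + r * 1 - X0 - rho) by rewrite mulr_ge0 //; lra.
lra.
Qed.

End Separation.

(** * The characterization of invariant sets *)

Theorem theorem2 (R : realType) (m : nat) (K C : set 'rV[R]_m)
    (coneK : convex_cone K) (closedK : closed K) (nonzeroK : K <> [set 0])
    (closedC : closed C) (convexC : @convex_set R 'rV[R]_m C)
    (interiorC : interior C !=set0) :
  K_invariant K C <->
  exists (I : set nat) (u a : nat -> 'rV[R]_m),
    C = \bigcap_(i in I) lower_halfspace (u i) (a i) /\
    forall i, I i ->
      [/\ u i != 0,
          tangent_hyperplane C (hyperplane (u i) (a i))
        & K_invariant K (hyperplane (u i) (a i))].
Proof.
split=> [invC|[I [u [a [-> Iua]]]]]; last first.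
  apply: bigcap_invariant => i /Iua[u0 _ inv].
  exact: lower_halfspace_invariant.
have [->|CT] := pselect (C = setT).
  (* The whole space has no boundary; it is the empty intersection. *)
  by exists set0, (fun=> 0), (fun=> 0); rewrite bigcap_set0.
(* Numbers coding no rational vector get centre 0, harmlessly: every interior centre yields a valid
   halfspace. *)
pose center i : 'rV[R]_m :=
  map_mx ratr (odflt 0 (unpickle i : option 'rV[rat]_m)).
pose I := [set i | interior C (center i)].
have /choice[er erP] : forall i, exists er, I i ->
    touching_ball C (center i) er.1 er.2.
  move=> i; have [Ii|nIi] := pselect (I i); last by exists (0, 0).
  by have [e [r tb]] := touching_ball_exists closedC CT Ii; exists (e, r).
exists I, (fun i => (er i).1), (fun i => center i + (er i).2 *: (er i).1).
split; last first.
  move=> i /erP tb; split.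
  - case: tb => ee _ _ _; apply: contra_eq_neq ee => ->.
    by rewrite dot0r eq_sym oner_eq0.
  - by exists (center i + (er i).2 *: (er i).1); exact: touching_ball_tangent.
  - exact: (touching_ball_invariant coneK closedK closedC convexC tb).
apply/seteqP; split=> y Cy.
  by move=> i /erP tb; exact: (touching_ball_support closedC convexC tb Cy).
apply: contrapT => nCy; have [x0 Cx0] := interiorC.
have [v [Cv sep]] := touching_ball_separation closedC convexC Cx0 nCy.
have cv : center (pickle v) = map_mx ratr v by rewrite /center pickleK.
have Iv : I (pickle v) by rewrite /I /= cv.
have := erP _ Iv; rewrite cv => /sep; rewrite -cv.
by have := Cy _ Iv; rewrite /lower_halfspace /= leNgt => /negP.
Qed.
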